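(* Let $\omega$ be a non-principal ultrafilter on $\mathbb N$ and let $\big((X_i,d_i,\mathfrak m_i,p_i)\big)_{i\in\mathbb N}$ be an $\omega$-uniformly boundedly finite sequence of pointed metric measure spaces. Then the family $\bar{\mathcal B}_\omega$ is a $\sigma$-algebra on $O(\bar X_\omega)$, and the set-function $\bar{\mathfrak m}_\omega\colon\bar{\mathcal B}_\omega\to[0,+\infty]$ is a (countably-additive) measure on $\bar{\mathcal B}_\omega$.
   Context: For a metric space $(X,d)$, $B(x,r)$ is the open ball and ${\rm Ball}(X)$ is the $\sigma$-algebra generated by open balls. A metric measure space $(X,d,\mathfrak m)$ is a metric space with a measure $\mathfrak m$ on ${\rm Ball}(X)$; pointed means that a point $p\in X$ is chosen. ''For $\omega$-a.e. $i$'' means for all $i$ in some element of $\omega$; $\lim_{i\to\omega}$ is the ultralimit along $\omega$ (in $[0,+\infty]$ for numbers). $\omega$-uniformly boundedly finite: there is $\eta\colon(0,+\infty)\to(0,+\infty)$ such that for every $R>0$, $\mathfrak m_i(B(p_i,R))\le\eta(R)$ for $\omega$-a.e. $i$. Ultraproduct: $\bar X_\omega$ is the set of families $(x_i)_{i\in S}$, $S\in\omega$, $x_i\in X_i$, modulo equality for $\omega$-a.e. $i$; classes are denoted $[x_i]$. $\bar d_\omega([x_i],[y_i]):=\lim_{i\to\omega}d_i(x_i,y_i)\in[0,+\infty]$ and $O(\bar X_\omega):=\{[x_i]:\bar d_\omega([x_i],[p_i])<+\infty\}$. Internal measurable sets: for $S\in\omega$ and $A_i\in{\rm Ball}(X_i)$,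 $i\in S$, let $\Pi_{i\to\omega}A_i:=\{[x_i]\in\bar X_\omega: x_i\in A_i\text{ for }\omega\text{-a.e. }i\}$. $\mathcal A(\bar X_\omega)$ is the family of all such sets, and $\mathcal A_O(\bar X_\omega):=\{\bar A\cap O(\bar X_\omega):\bar A\in\mathcal A(\bar X_\omega)\}$. On $\mathcal A_O(\bar X_\omega)$ put $$\bar{\mathfrak m}_\omega\big((\Pi_{i\to\omega}A_i)\cap O(\bar X_\omega)\big):=\lim_{R\to\infty}\lim_{i\to\omega}\mathfrak m_i\big(A_i\cap B(p_i,R)\big)$$ (this is well-defined). Null sets: $N\subset O(\bar X_\omega)$ belongs to $\mathcal N_\omega$ if for every $\varepsilon>0$ there is $\bar A\in\mathcal A_O(\bar X_\omega)$ with $N\subset\bar A$ and $\bar{\mathfrak m}_\omega(\bar A)<\varepsilon$. $\bar{\mathcal B}_\omega$ is the family of all $A\subset O(\bar X_\omega)$ such that for every $R>0$ there is $\bar A_R\in\mathcal A_O(\bar X_\omega)$ with $\big(A\cap\Pi_{i\to\omega}B(p_i,R)\big)\Delta\bar A_R\in\mathcal N_\omega$. For $A\in\bar{\mathcal B}_\omega$ put $\bar{\mathfrak m}_\omega(A):=\lim_{R\to\infty}\bar{\mathfrak m}_\omega(\bar A_R)$, where, for each $R>0$, $\bar A_R\in\mathcal A_O(\bar X_\omega)$ is any set with $\big(A\cap\Pi_{i\to\omega}B(p_i,R)\big)\Delta\bar A_R\in\mathcal N_\omega$ (the value does not depend on the choice of the sets $\bar A_R$, and this extends the set-function $\bar{\mathfrak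 m}_\omega$ defined on $\mathcal A_O(\bar X_\omega)$ by the displayed formula). *)

(* Defs.v *)
From HB Require Import structures.
From mathcomp Require Import all_boot all_order all_algebra generic_quotient.
From mathcomp Require Import all_classical all_reals all_analysis.

Set Implicit Arguments.
Unset Strict Implicit.
Unset Printing Implicit Defensive.

Import Order.TTheory GRing.Theory Num.Theory.
Import numFieldNormedType.Exports.
Local Open Scope classical_set_scope.
Local Open Scope ring_scope.
Local Open Scope quotient_scope.

(* The base point p is [point]. *)
#[short(type="pointedMetricType")]
HB.structure Definition PointedMetric (R : numDomainType) :=
  {T of Pointed T & Metric R T}.

Section ball_sigma_algebra.
Context {R : realType} (T : pointedMetricType R).

Definition open_balls : set_system T := [set B | exists x r, B = ball x r].

Definition ballMeasurableType := g_sigma_algebraType open_balls.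

HB.instance Definition _ := Measurable.on ballMeasurableType.

End ball_sigma_algebra.

Definition unif_boundedly_finite {R : realType} (omega : set_system nat)
    (X : nat -> pointedMetricType R)
    (m : forall i, {measure set (ballMeasurableType (X i)) -> \bar R}) :=
  exists2 eta : R -> R, (forall r, 0 < r -> 0 < eta r) &
    forall r, 0 < r ->
      \forall i \near omega, (m i (ball (point : X i) r) <= (eta r)%:E)%E.

Section ultraproduct.
Context {R : realType} (omega : set_system nat) {UF : UltraFilter omega}
        (X : nat -> pointedMetricType R).

(* A family (x_i)_{i \in S} with S \in omega; S is the set of those i where the
   value is not None. *)
Record ufamily := UFamily {
  ufamily_val :> forall i, option (X i) ;
  ufamily_dom : \forall i \near omega, ufamily_val i }.

HB.instance Definition _ := gen_eqMixin ufamily.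
HB.instance Definition _ := gen_choiceMixin ufamily.

Definition ufamily_eq (x y : ufamily) : bool :=
  `[< \forall i \near omega, x i = y i >].

Lemma ufamily_eq_refl : reflexive ufamily_eq.
Proof. by move=> x; apply/asboolP; apply: filterE. Qed.

Lemma ufamily_eq_sym : symmetric ufamily_eq.
Proof.
by move=> x y; apply/asboolP/asboolP; apply: filterS => i ->.
Qed.

Lemma ufamily_eq_trans : transitive ufamily_eq.
Proof.
move=> y x z /asboolP xy /asboolP yz; apply/asboolP.
by apply: filterS2 xy yz => i -> ->.
Qed.

Canonical ufamily_eq_equiv :=
  EquivRel ufamily_eq ufamily_eq_refl ufamily_eq_sym ufamily_eq_trans.

Definition uprod := {eq_quot ufamily_eq}.

(* Off the domain of the family the base point is used; this only concerns
   indices outside some element of omega. *)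
Definition uval (x : ufamily) i : X i := odflt point (x i).

Definition udist (x y : uprod) : \bar R :=
  lim ((mdist (uval (repr x) i) (uval (repr y) i))%:E @[i --> omega]).

Lemma ubase_dom : \forall i \near omega, Some (point : X i).
Proof. exact: filterE. Qed.

Definition ubase : uprod := \pi_uprod (UFamily ubase_dom).

Definition ufin : set uprod := [set x | (udist x ubase < +oo)%E].

Definition ulim (A : forall i, set (X i)) : set uprod :=
  [set \pi_uprod x | x in
    [set x : ufamily | \forall i \near omega, exists2 a, x i = Some a & A i a]].

(* A family A_i \in Ball(X_i), i \in S, with S \in omega; the sets A_i with i
   outside S are arbitrary and do not affect the ultralimits. *)
Definition umeasurable (A : forall i, set (X i)) :=
  \forall i \near omega, measurable (A i : set (ballMeasurableType (X i))).

Definition internal : set_system uprod :=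
  [set ulim A | A in [set A | umeasurable A]].

Definition internalO : set_system uprod :=
  [set A `&` ufin | A in internal].

Context (m : forall i, {measure set (ballMeasurableType (X i)) -> \bar R}).

Definition ulim_content (A : forall i, set (X i)) : \bar R :=
  lim (lim (m i (A i `&` ball (point : X i) r) @[i --> omega])
       @[r --> +oo%R]).

(* The value does not depend on the family A representing D: see contentOE. *)
Definition contentO (D : set uprod) : \bar R :=
  xget 0%E [set ulim_content A | A in
    [set A | umeasurable A /\ D = ulim A `&` ufin]].

Definition unull : set_system uprod :=
  [set N | N `<=` ufin /\
    forall e : R, 0 < e ->
      exists A, [/\ internalO A, N `<=` A & (contentO A < e%:E)%E]].

Definition uball (r : R) : set uprod := ulim (fun i => ball (point : X i) r).

Definition uapprox (A : set uprod) (r : R) (D : set uprod) :=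
  internalO D /\ unull ((A `&` uball r) `+` D).

Definition usigma : set_system uprod :=
  [set A | A `<=` ufin /\ forall r, 0 < r -> exists D, uapprox A r D].

(* The value does not depend on the approximating sets D r: see umeasureE. *)
Definition umeasure (A : set uprod) : \bar R :=
  xget 0%E [set lim (contentO (D r) @[r --> +oo%R]) | D in
    [set D : R -> set uprod | forall r, 0 < r -> uapprox A r (D r)]].

End ultraproduct.

Arguments uprod {R} omega {UF} X.
Arguments udist {R} omega {UF} X x y.
Arguments ubase {R} omega {UF} X.
Arguments ufin {R} omega {UF} X.
Arguments ulim {R} omega {UF} [X] A.
Arguments internal {R} omega {UF} X.
Arguments internalO {R} omega {UF} X.
Arguments uball {R} omega {UF} X r.
Arguments ulim_content {R} omega [X] m A.
Arguments contentO {R} omega {UF} [X] m D.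
Arguments unull {R} omega {UF} [X] m.
Arguments uapprox {R} omega {UF} [X] m A r D.
Arguments usigma {R} omega {UF} [X] m.
Arguments umeasure {R} omega {UF} [X] m A.

Section well_definedness.
Context {R : realType} (omega : set_system nat) {UF : UltraFilter omega}
        (X : nat -> pointedMetricType R).
Local Notation U := (uprod omega X).

Lemma ultra_cvg (u : nat -> \bar R) : cvg (u i @[i --> omega]).
Proof.
have cp := @segment_compact R (-1) 1.
pose F := (fun i => contract (u i)) @ omega.
have FA : F `[-1, 1]%classic.
  suff : omega [set i | (`[-1, 1]%classic : set R) (contract (u i))] by [].
  apply: filterE => i /=; rewrite in_itv/=.
  by have := contract_le1 (u i); rewrite ler_norml.
have [] := cp F _ FA.
move=> c [c1 cl]; apply/cvg_ex; exists (expand c); apply/cvg_ballP => e e0.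
have [//|h] := in_ultra_setVsetC [set i | ball (expand c) e (u i)] UF.
have FB : F [set x | ~ ball c e x].
  suff : omega [set i | ~ ball c e (contract (u i))] by [].
  apply: filterS h => i; apply: contra_not.
  rewrite /ball/= /ereal_ball/= expandK//.
  by move: c1; rewrite /= in_itv/= inE ler_norml.
by have [? []] := cl _ _ FB (nbhsx_ballx c e e0).
Qed.

Lemma ufamily_eqP (x y : ufamily omega X) :
  \pi_U x = \pi_U y <-> \forall i \near omega, x i = y i.
Proof.
split; first by move=> /eqmodP/asboolP.
by move=> h; apply/eqmodP/asboolP.
Qed.

Lemma ulimP (A : forall i, set (X i)) (x : ufamily omega X) :
  ulim omega A (\pi_U x) <->
  \forall i \near omega, exists2 a, x i = Some a & A i a.
Proof.
split=> [[y /= yA /ufamily_eqP yx]|xA]; last by exists x.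
by apply: filterS2 yA yx => i [a ya Aa] <-; exists a.
Qed.

Lemma udistE (x y : ufamily omega X) :
  udist omega X (\pi_U x) (\pi_U y) =
  lim ((mdist (uval x i) (uval y i))%:E @[i --> omega]).
Proof.
have /ufamily_eqP ex : \pi_U (repr (\pi_U x)) = \pi_U x by rewrite reprK.
have /ufamily_eqP ey : \pi_U (repr (\pi_U y)) = \pi_U y by rewrite reprK.
rewrite /udist; congr (lim _); apply/seteqP; split; apply: near_eq_cvg;
by apply: filterS2 ex ey => i ex ey; rewrite /uval ex ey.
Qed.

Lemma ufin_bounded (x : ufamily omega X) r :
  (\forall i \near omega, ball point r (uval x i)) -> ufin omega X (\pi_U x).
Proof.
move=> h; rewrite /ufin/= /ubase udistE (@le_lt_trans _ _ r%:E) ?ltry//.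
apply: lime_le; first exact: ultra_cvg.
by apply: filterS h => i; rewrite ballEmdist/= lee_fin metric_sym => /ltW.
Qed.

Lemma ufinP (x : ufamily omega X) :
  ufin omega X (\pi_U x) -> exists2 r, 0 < r & uball omega X r (\pi_U x).
Proof.
rewrite /ufin/= /ubase udistE => h.
pose l := lim ((mdist (uval x i) (point : X i))%:E @[i --> omega]).
have cl : (mdist (uval x i) (point : X i))%:E @[i --> omega] --> l.
  exact: ultra_cvg.
have l0 : (0 <= l)%E.
  apply: lime_ge; first exact: ultra_cvg.
  by apply: filterE => i; rewrite lee_fin mdist_ge0.
have lf : l \is a fin_num by rewrite ge0_fin_numE.
exists (fine l + 1); first by rewrite ltr_wpDl// fine_ge0.
apply/ulimP.
rewrite -(fineK lf) in cl.
have /fine_cvgP[_ cl'] := cl.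
have := cvgr_lt _ cl' (fine l + 1) _; rewrite ltrDl ltr01 => /(_ _ isT).
have := ufamily_dom x.
apply: filterS2 => i; case E : (x i) => [a|]// _ /=.
rewrite /uval E/= => h'; exists a => //.
by rewrite ballEmdist/= metric_sym.
Qed.

Context (m : forall i, {measure set (ballMeasurableType (X i)) -> \bar R}).

Lemma ulim_sub_near (A B : forall i, set (X i)) r :
  ulim omega A `&` ufin omega X `<=` ulim omega B ->
  \forall i \near omega, A i `&` ball (point : X i) r `<=` B i.
Proof.
move=> AB.
have [//|h] := in_ultra_setVsetC
  [set i | A i `&` ball (point : X i) r `<=` B i] UF.
exfalso.
pose P i (a : X i) := [/\ A i a, ball (point : X i) r a & ~ B i a].
pose f i : option (X i) := if pselect (exists a, P i a) is left e
  then Some (projT1 (cid e)) else None.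
have hf : \forall i \near omega, exists2 a, f i = Some a & P i a.
  apply: filterS h => i /= /existsNP[a /not_implyP[[Aa ba] Ba]].
  rewrite /f; case: pselect => [e|[]]; last by exists a.
  by case: cid => b Pb /=; exists b.
have df : \forall i \near omega, f i by apply: filterS hf => i [a ->].
pose x := UFamily df.
have : ulim omega B (\pi_U x).
  apply: AB; split.
    by apply/ulimP; apply: filterS hf => i [a ? []]; exists a.
  apply: (@ufin_bounded _ r); apply: filterS hf => i [a fa [_ ba _]].
  by rewrite /uval/= fa.
move/ulimP => xB.
have : \forall i \near omega, False.
  by apply: filterS2 xB hf => i [a /= fa Ba] [b]; rewrite fa => -[<-] [].
by move/filter_ex => [].
Qed.

Let mc i (A : set (X i)) := measurable (A : set (ballMeasurableType (X i))).

Lemma mball i r : mc (ball (point : X i) r).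
Proof. by apply: sub_sigma_algebra; exists point, r. Qed.

Lemma mball_int A r : umeasurable omega A ->
  \forall i \near omega, mc (A i `&` ball (point : X i) r).
Proof. by apply: filterS => i Ai; apply: measurableI => //; exact: mball. Qed.

Lemma content_r_ge0 A r :
  (0 <= lim (m i (A i `&` ball (point : X i) r) @[i --> omega]))%E.
Proof. by apply: lime_ge; [exact: ultra_cvg|exact: filterE]. Qed.

Lemma content_cvg A : umeasurable omega A ->
  cvg (lim (m i (A i `&` ball (point : X i) r) @[i --> omega]) @[r --> +oo%R]).
Proof.
move=> mA; apply: nondecreasing_is_cvge => r s rs.
apply: lee_lim; [exact: ultra_cvg|exact: ultra_cvg|].
apply: filterS2 (mball_int r mA) (mball_int s mA) => i mr ms.
apply: le_measure; rewrite ?inE//; apply: setIS; exact: le_ball.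
Qed.

Lemma content_ge0 A : umeasurable omega A -> (0 <= ulim_content omega m A)%E.
Proof.
move=> mA; apply: lime_ge; first exact: content_cvg.
by apply: filterE => r; exact: content_r_ge0.
Qed.

Lemma content_subset A B : umeasurable omega A -> umeasurable omega B ->
  ulim omega A `&` ufin omega X `<=` ulim omega B ->
  (ulim_content omega m A <= ulim_content omega m B)%E.
Proof.
move=> mA mB AB; apply: lee_lim; [exact: content_cvg|exact: content_cvg|].
apply: filterE => r; apply: lee_lim; [exact: ultra_cvg|exact: ultra_cvg|].
have h := ulim_sub_near r AB.
apply: filterS3 h (mball_int r mA) (mball_int r mB) => i sub mr ms.
by apply: le_measure; rewrite ?inE// => x [Ax bx]; split => //; exact: sub.
Qed.

Lemma contentOE A : umeasurable omega A ->
  contentO omega m (ulim omega A `&` ufin omega X) = ulim_content omega m A.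
Proof.
move=> mA; apply: xget_unique; first by exists A.
move=> _ [B [mB e] <-]; apply/eqP; rewrite eq_le; apply/andP; split.
  by apply: content_subset => //; rewrite -e; apply: subIsetl.
by apply: content_subset => //; rewrite e; apply: subIsetl.
Qed.

Lemma content_subU A B C : umeasurable omega A -> umeasurable omega B ->
  umeasurable omega C -> 
  ulim omega A `&` ufin omega X `<=` ulim omega B `|` ulim omega C ->
  (ulim_content omega m A <= ulim_content omega m B + ulim_content omega m C)%E.
Proof.
move=> mA mB mC ABC.
have cB := content_cvg mB; have cC := content_cvg mC.
have dBC : (ulim_content omega m B +? ulim_content omega m C)%E.
  by apply: ge0_adde_def; rewrite inE content_ge0.
rewrite -(limeD cB cC dBC); apply: lee_lim; [exact: content_cvg| |].
  by apply: is_cvgeD.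
apply: filterE => r /=.
rewrite -limeD; try exact: ultra_cvg; last first.
  by apply: ge0_adde_def; rewrite inE content_r_ge0.
apply: lee_lim; [exact: ultra_cvg|exact: ultra_cvg|].
have AU : ulim omega A `&` ufin omega X `<=` ulim omega (fun i => B i `|` C i).
  move=> x /ABC; rewrite -[x]reprK => -[] /ulimP h; apply/ulimP;
  apply: filterS h => i [a]; exists a => //; by [left|right].
have h := ulim_sub_near r AU.
have h2 : \forall i \near omega, mc (A i `&` ball (point : X i) r) /\
    mc (B i `&` ball (point : X i) r).
  by apply: filterS2 (mball_int r mA) (mball_int r mB).
apply: filterS3 h h2 (mball_int r mC) => i sub [mr ms] mt.
apply: le_trans (measureU2 _ ms mt).
apply: le_measure; rewrite ?inE//; first exact: measurableU.
by move=> x [Ax bx]; have [] : (B i `|` C i) x; [exact: sub|left|right].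
Qed.

Lemma unullU N1 N2 : unull omega m N1 -> unull omega m N2 ->
  unull omega m (N1 `|` N2).
Proof.
move=> [s1 h1] [s2 h2]; split; first by rewrite subUset.
move=> e e0; have e2 : 0 < e / 2 by rewrite divr_gt0.
have [_ [[_ [A mA <-] <-] N1A Ae]] := h1 _ e2.
have [_ [[_ [B mB <-] <-] N2B Be]] := h2 _ e2.
pose C i := A i `|` B i.
have mC : umeasurable omega C.
  by apply: filterS2 mA mB => i ? ?; exact: measurableU.
exists (ulim omega C `&` ufin omega X); split.
- by exists (ulim omega C) => //; exists C.
- move=> x [/N1A[+ ?]|/N2B[+ ?]]; rewrite -[x]reprK => /ulimP h;
  (split; last by rewrite reprK);
  apply/ulimP; apply: filterS h => i [a]; exists a => //; by [left|right].
rewrite contentOE// [e]splitr EFinD.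
apply: (@le_lt_trans _ _ (ulim_content omega m A + ulim_content omega m B)%E).
  apply: content_subU => // x [+ _]; rewrite -[x]reprK => /ulimP h.
  have [h'|h'] := in_ultra_setVsetC
    [set i | exists2 a, repr x i = Some a & A i a] UF.
    by left; apply/ulimP.
  right; apply/ulimP; apply: filterS2 h h' => i [a xa [Aa|Ba]] /=;
    last by exists a.
  by move=> []; exists a.
by apply: lteD; rewrite -contentOE.
Qed.

Lemma unullS N1 N2 : N1 `<=` N2 -> unull omega m N2 -> unull omega m N1.
Proof.
move=> s [sf h]; split; first exact: subset_trans sf.
by move=> e /h[A [? ? ?]]; exists A; split => //; exact: subset_trans s _.
Qed.

Lemma unull_content A : umeasurable omega A ->
  unull omega m (ulim omega A `&` ufin omega X) ->
  ulim_content omega m A = 0%E.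
Proof.
move=> mA [_ h]; apply/eqP; rewrite eq_le content_ge0// andbT.
apply/lee_addgt0Pr => e e0; rewrite add0e.
have [_ [[_ [B mB <-] <-] AB]] := h _ e0.
rewrite contentOE// => /ltW; apply: le_trans; apply: content_subset => //.
by apply: subset_trans AB _; exact: subIsetl.
Qed.

Lemma contentO_le D D' : internalO omega X D -> internalO omega X D' ->
  unull omega m (D `\` D') -> (contentO omega m D <= contentO omega m D')%E.
Proof.
move=> [_ [A mA <-] <-] [_ [B mB <-] <-] nu.
pose C i := A i `\` B i.
have mC : umeasurable omega C.
  by apply: filterS2 mA mB => i ? ?; exact: measurableD.
rewrite !contentOE// -[leRHS]adde0 -(@unull_content C mC).
  apply: content_subU => // x [+ _]; rewrite -[x]reprK => /ulimP h.
  have [h'|h'] := in_ultra_setVsetC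
    [set i | exists2 a, repr x i = Some a & B i a] UF.
    by left; apply/ulimP.
  right; apply/ulimP; apply: filterS2 h h' => i [a xa Aa] /= nB; exists a => //.
  by split => // Ba; apply: nB; exists a.
apply: unullS nu => x []; rewrite -[x]reprK => /ulimP h fx; split; last first.
  move=> [/ulimP h' _].
  have : \forall i \near omega, False; last by move/filter_ex => [].
  by apply: filterS2 h h' => i [a -> [_ Ba]] [b [<-]].
by split => //; apply/ulimP; apply: filterS h => i [a ? []]; exists a.
Qed.

Lemma uapprox_content A r D D' :
  uapprox omega m A r D -> uapprox omega m A r D' ->
  contentO omega m D = contentO omega m D'.
Proof.
have H E E' : uapprox omega m A r E -> uapprox omega m A r E' ->
  (contentO omega m E <= contentO omega m E')%E.
  move=> [iE nE] [iE' nE']; apply: contentO_le => //.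
  apply: unullS (unullU nE nE') => x [Ex E'x].
  have [?|?] := pselect ((A `&` uball omega X r) x).
    by right; left.
  by left; right.
by move=> d d'; apply/eqP; rewrite eq_le !H.
Qed.

Lemma umeasureE A (D : R -> set (uprod omega X)) :
  (forall r, 0 < r -> uapprox omega m A r (D r)) ->
  umeasure omega m A = lim (contentO omega m (D r) @[r --> +oo%R]).
Proof.
move=> hD; apply: xget_unique; first by exists D.
move=> _ [D' hD' <-]; congr (lim _).
have H E E' : (forall r, 0 < r -> uapprox omega m A r (E r)) ->
  (forall r, 0 < r -> uapprox omega m A r (E' r)) ->
  \forall r \near +oo%R, contentO omega m (E r) = contentO omega m (E' r).
  move=> hE hE'; apply: filterS (nbhs_pinfty_gt (num_real (0 : R))) => r r0.
  by apply: uapprox_content; [exact: hE|exact: hE'].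
by apply/seteqP; split; apply: near_eq_cvg; exact: H.
Qed.
End well_definedness.

(* Measures in the library live on a whole measurable type; here B is a
   sigma-algebra on a subset of T, so the conditions of isMeasure are
   restricted to B. *)
Definition is_measure_on {R : realType} {T : Type} (B : set_system T)
    (mu : set T -> \bar R) :=
  [/\ mu set0 = 0%E,
      forall A, B A -> (0 <= mu A)%E &
      forall F : (set T)^nat, (forall n, B (F n)) -> trivIset setT F ->
        (\sum_(0 <= k < n) mu (F k))%E @[n --> \oo] --> mu (\bigcup_n F n)].

(* Main.v *)
(* This is the Loeb measure construction. On the ring of internal sets the
   content is finitely additive, being an iterated limit of measures. As omega
   is non-principal, a diagonal argument (saturation) shows that countably many
   internal sets whose finite unions have content at most c < +oo are all
   contained in one internal set of content at most c. This makes null sets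
   closed under countable unions, and, inside a ball, where contents are finite,
   it yields for a countable union an internal set that approximates it up to a
   null set and whose content is the supremum of those of the finite unions. *)
Require Import Defs.
From HB Require Import structures.
From mathcomp Require Import all_boot all_order all_algebra generic_quotient.
From mathcomp Require Import all_classical all_reals all_analysis.

Set Implicit Arguments.
Unset Strict Implicit.
Unset Printing Implicit Defensive.

Import Order.TTheory GRing.Theory Num.Theory.
Import numFieldNormedType.Exports.
Local Open Scope classical_set_scope.
Local Open Scope ring_scope.

(** * Ultrafilters on the natural numbers *)

Section ultrafilter_on_nat.
Context (omega : set_system nat) {UF : UltraFilter omega}.

Lemma near_not (P : nat -> Prop) :
  (\forall i \near omega, ~ P i) -> ~ \forall i \near omega, P i.
Proof.
move=> nP hP; have : \forall i \near omega, False by apply: filterS2 nP hP.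
by move/filter_ex => [].
Qed.

Lemma ultra_not (P : nat -> Prop) :
  ~ (\forall i \near omega, P i) -> \forall i \near omega, ~ P i.
Proof. by move=> nP; have [|] := in_ultra_setVsetC [set i | P i] UF. Qed.

Lemma ultra_or (P Q : nat -> Prop) :
  (\forall i \near omega, P i \/ Q i) <->
  (\forall i \near omega, P i) \/ (\forall i \near omega, Q i).
Proof.
split=> [PQ|[]]; [|by apply: filterS; left|by apply: filterS; right].
have [?|nP] := pselect (\forall i \near omega, P i); first by left.
by right; move/ultra_not : nP => nP; apply: filterS2 PQ nP => i [].
Qed.

(** Each induction step discards one point [n]: if [{n}] belonged to [omega], then [omega] would be
    the principal filter at [n]. *)
Lemma nonprincipal_near_geq :
  (forall n, omega <> principal_filter n) ->
  forall n, \forall i \near omega, (n <= i)%N.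
Proof.
move=> np; elim=> [|n IH]; first exact: filterE.
suff : \forall i \near omega, i <> n.
  by apply: filterS2 IH => i ni /eqP; rewrite ltn_neqAle eq_sym ni andbT.
apply: ultra_not => on; apply: (np n); apply/seteqP; split => A.
  move=> oA; apply/principal_filterP; apply: contrapT => nA.
  have : \forall i \near omega, False.
    by apply: filterS2 on oA => i -> /nA.
  by move/filter_ex => [].
move=> /principal_filterP An.
by apply: filterS on => i ->.
Qed.

End ultrafilter_on_nat.

(** * Boolean operations on internal sets and ultraproducts of balls *)

Section internal_sets.
Context {R : realType} (omega : set_system nat) {UF : UltraFilter omega}
        (X : nat -> pointedMetricType R).
Local Notation U := (uprod omega X).
Implicit Types A B : forall i, set (X i).

(** Passing from the partial family to the total one [uval] only affects indices outside an element
    of [omega]; membership becomes a pointwise condition without domains. *)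
Lemma ulim_repr A (x : U) :
  ulim omega A x <-> \forall i \near omega, A i (uval (repr x) i).
Proof.
rewrite -{1}[x]reprK ulimP; split.
  by apply: filterS => i [a xa Aa]; rewrite /uval xa.
have := ufamily_dom (repr x); apply: filterS2 => i.
by rewrite /uval; case: (repr x i) => // a _ Aa; exists a.
Qed.

Lemma ulim0 : ulim omega (fun i => set0 : set (X i)) = set0.
Proof. by apply/seteqP; split=> x // /ulim_repr /filter_ex[]. Qed.

Lemma ulimU A B : ulim omega (fun i => A i `|` B i) =
  ulim omega A `|` ulim omega B.
Proof.
apply/seteqP; split=> x.
  by move=> /ulim_repr/ultra_or[] h; [left|right]; apply/ulim_repr.
by move=> h; apply/ulim_repr/ultra_or; case: h => /ulim_repr; [left|right].
Qed.

(** Maximality of [omega] enters here: not being in [B i] for almost all [i] means being outside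
    [B i] for almost all [i]. *)
Lemma ulimD A B : ulim omega (fun i => A i `\` B i) =
  ulim omega A `\` ulim omega B.
Proof.
apply/seteqP; split=> x.
  move=> /ulim_repr h; split.
    by apply/ulim_repr; apply: filterS h => i [].
  by move/ulim_repr; apply: near_not; apply: filterS h => i [].
move=> [/ulim_repr Ax Bx]; apply/ulim_repr.
have : \forall i \near omega, ~ B i (uval (repr x) i).
  by apply: ultra_not => /ulim_repr.
exact: filterS2 Ax.
Qed.

Lemma ulim_bigsetU (A : nat -> forall i, set (X i)) n :
  ulim omega (fun i => \big[setU/set0]_(k < n) A k i) =
  \big[setU/set0]_(k < n) ulim omega (A k).
Proof.
elim: n => [|n IH].
  rewrite big_ord0 -ulim0; congr (ulim omega _).
  by apply: functional_extensionality_dep => i; rewrite big_ord0.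
rewrite big_ord_recr/= -IH -ulimU; congr (ulim omega _).
by apply: functional_extensionality_dep => i; rewrite big_ord_recr.
Qed.

Lemma internalO_ulim A :
  umeasurable omega A -> internalO omega X (ulim omega A `&` ufin omega X).
Proof. by move=> mA; exists (ulim omega A) => //; exists A. Qed.

Lemma internalO_ufin D : internalO omega X D -> D `<=` ufin omega X.
Proof. by move=> [E _ <-] x []. Qed.

Lemma internalO0 : internalO omega X set0.
Proof.
rewrite -(set0I (ufin omega X)) -ulim0; apply: internalO_ulim.
by apply: filterE => i; exact: measurable0.
Qed.

Lemma internalOU D E :
  internalO omega X D -> internalO omega X E -> internalO omega X (D `|` E).
Proof.
move=> [_ [A mA <-] <-] [_ [B mB <-] <-]; rewrite -setIUl -ulimU.
apply: internalO_ulim; apply: filterS2 mA mB => i; exact: measurableU.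
Qed.

Lemma internalOD D E :
  internalO omega X D -> internalO omega X E -> internalO omega X (D `\` E).
Proof.
move=> [_ [A mA <-] <-] [_ [B mB <-] <-].
rewrite (_ : _ `\` _ = (ulim omega A `\` ulim omega B) `&` ufin omega X).
  rewrite -ulimD; apply: internalO_ulim.
  by apply: filterS2 mA mB => i; exact: measurableD.
apply/seteqP; split=> x [].
  by move=> [Ax fx] nBx; split=> //; split=> // Bx; exact: nBx.
by move=> [Ax nBx] fx; split=> // -[].
Qed.

Lemma internalOI D E :
  internalO omega X D -> internalO omega X E -> internalO omega X (D `&` E).
Proof. by move=> iD iE; rewrite -setDD; do 2 apply: internalOD => //. Qed.

Lemma uball_ufin r : uball omega X r `<=` ufin omega X.
Proof.
move=> x /ulim_repr h; rewrite -[x]reprK; exact: ufin_bounded h.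
Qed.

Lemma internalO_uball r : internalO omega X (uball omega X r).
Proof.
rewrite -(setIidl (@uball_ufin r)); apply: internalO_ulim.
by apply: filterE => i; exact: mball.
Qed.

Lemma uball_le r s : r <= s -> uball omega X r `<=` uball omega X s.
Proof.
move=> rs x /ulim_repr h; apply/ulim_repr.
by apply: filterS h => i; exact: le_ball.
Qed.

End internal_sets.

(** * The content on internal sets, and saturation *)

Section content.
Context {R : realType} (omega : set_system nat) {UF : UltraFilter omega}
        (X : nat -> pointedMetricType R)
        (m : forall i, {measure set (ballMeasurableType (X i)) -> \bar R}).
Local Notation iO := (internalO omega X).
Local Notation mu := (contentO omega m).

Lemma contentO_ge0 D : iO D -> (0 <= mu D)%E.
Proof. by move=> [_ [A mA <-] <-]; rewrite contentOE// content_ge0. Qed.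

Lemma unull0 : unull omega m set0.
Proof.
split=> // e e0; exists set0; split=> //; first exact: internalO0.
rewrite (_ : mu set0 = 0%E) ?lte_fin//.
rewrite -(set0I (ufin omega X)) -ulim0 contentOE; last first.
  by apply: filterE => i; exact: measurable0.
rewrite /ulim_content; under eq_fun do under eq_fun do rewrite set0I measure0.
under eq_fun do rewrite lim_cst//.
by rewrite lim_cst.
Qed.

Lemma contentO0 : mu set0 = 0%E.
Proof.
have [_ [A mA <-] e] := @internalO0 R omega UF X.
rewrite -e contentOE// unull_content// e; exact: unull0.
Qed.

Lemma le_contentO D E : iO D -> iO E -> D `<=` E -> (mu D <= mu E)%E.
Proof.
move=> iD iE DE; apply: contentO_le => //.
have -> : D `\` E = set0 by apply/seteqP; split=> x //= [/DE].
exact: unull0.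
Qed.

Lemma eq_contentO D E : iO D -> iO E -> unull omega m (D `+` E) ->
  mu D = mu E.
Proof.
move=> iD iE DE; apply/eqP; rewrite eq_le; apply/andP; split;
  apply: contentO_le => //; apply: unullS DE => x ?; by [left|right].
Qed.

Lemma contentO_null D : iO D -> unull omega m D -> mu D = 0%E.
Proof.
by move=> iD nD; rewrite (@eq_contentO _ set0)// ?contentO0//;
  [exact: internalO0|rewrite /setY setD0 set0D setU0].
Qed.

(* Additivity passes to the ultralimit because both limits preserve sums. *)
Lemma contentOID D E : iO D -> iO E -> mu D = (mu (D `&` E) + mu (D `\` E))%E.
Proof.
move=> [_ [A mA <-] <-] [_ [B mB <-] <-].
(* [Q i] is [A i] intersected with [B i], written as a double difference so that [ulimD] computes
   its ultraproduct. *)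
pose P i := A i `\` B i; pose Q i := A i `\` P i.
have mP : umeasurable omega P.
  by apply: filterS2 mA mB => i; exact: measurableD.
have mQ : umeasurable omega Q.
  by apply: filterS2 mA mP => i; exact: measurableD.
have -> : (ulim omega A `&` ufin omega X) `\` (ulim omega B `&` ufin omega X) =
    ulim omega P `&` ufin omega X.
  rewrite ulimD; apply/seteqP; split=> x [].
    by move=> [Ax fx] nBx; split=> //; split=> // Bx; exact: nBx.
  by move=> [Ax nBx] fx; split=> // -[].
have -> : ulim omega A `&` ufin omega X `&` (ulim omega B `&` ufin omega X) =
    ulim omega Q `&` ufin omega X.
  by rewrite !ulimD setDD setIACA setIid.
rewrite !contentOE//.
rewrite /ulim_content -limeD; [|exact: content_cvg|exact: content_cvg|]; last first.
  by apply: ge0_adde_def; rewrite inE content_ge0.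
apply: (congr1 (fun f : R -> \bar R => lim (f r @[r --> +oo%R]))).
apply/funext => r /=.
rewrite -limeD; [|exact: ultra_cvg|exact: ultra_cvg|]; last first.
  by apply: ge0_adde_def; rewrite inE content_r_ge0.
congr (lim _); apply/seteqP; split; apply: near_eq_cvg; last first.
  apply: filterS3 mA mB (mball_int r mA) => i Ai Bi Abi.
  rewrite addeC /Q setDD/=.
  rewrite [RHS](measureDI _ Abi Bi); congr (m i _ + m i _)%E.
    by rewrite /P !setDE setIAC.
  by rewrite setIAC.
apply: filterS3 mA mB (mball_int r mA) => i Ai Bi Abi.
rewrite addeC /Q setDD/=.
rewrite [LHS](measureDI _ Abi Bi); congr (m i _ + m i _)%E.
  by rewrite /P !setDE setIAC.
by rewrite setIAC.
Qed.

(** A null overlap is allowed because internal sets that approximate disjoint sets are disjoint only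
    up to a null set. *)
Lemma contentOU D E : iO D -> iO E -> unull omega m (D `&` E) ->
  mu (D `|` E) = (mu D + mu E)%E.
Proof.
move=> iD iE nDE; rewrite (@contentOID (D `|` E) D)//; last exact: internalOU.
rewrite setUK; congr (_ + _)%E; rewrite setDUl setDv set0U.
by rewrite [RHS](contentOID iE iD) [X in (_ = X + _)%E]contentO_null ?add0e//;
  [exact: internalOI|rewrite setIC].
Qed.

Lemma contentOU_le D E : iO D -> iO E -> (mu (D `|` E) <= mu D + mu E)%E.
Proof.
move=> iD iE; rewrite (@contentOID (D `|` E) D)//; last exact: internalOU.
rewrite setUK leeD2l// setDUl setDv set0U.
by apply: le_contentO => //; exact: internalOD.
Qed.

(** The bound [eta r] survives both limits, since intersecting with a further ball only decreases
    the mass. *)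
Lemma contentO_uball_lty r D : unif_boundedly_finite omega m -> 0 < r ->
  iO D -> D `<=` uball omega X r -> (mu D < +oo)%E.
Proof.
move=> [eta eta0 bf] r0 iD Dr; apply: (@le_lt_trans _ _ (eta r)%:E) (ltry _).
apply: (@le_trans _ _ (mu (uball omega X r))).
  by apply: le_contentO => //; exact: internalO_uball.
rewrite -(setIidl (@uball_ufin _ omega UF X r)).
have mr : umeasurable omega (fun i => ball (point : X i) r).
  by apply: filterE => i; exact: mball.
rewrite contentOE//; apply: lime_le; first exact: content_cvg.
apply: filterE => s; apply: lime_le; first exact: ultra_cvg.
apply: filterS (bf r r0) => i; apply: le_trans.
by apply: le_measure; rewrite ?inE//; [apply: measurableI| ]; exact: mball.
Qed.

(* The ball radius is tied to the index n so that a single diagonal choice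
   controls the content inside every ball. *)
Lemma near_content_lt A (c : R) n : umeasurable omega A ->
  (ulim_content omega m A <= c%:E)%E ->
  \forall i \near omega,
    (m i (A i `&` ball (point : X i) n%:R) < (c + n.+1%:R^-1)%:E)%E.
Proof.
move=> mA Ac.
(* Masses grow with the radius, so the limit at radius [n] is at most [c]; the margin [1/(n+1)]
   makes the inequality strict, an open condition that passes from the limit to almost all [i]. *)
have h : (lim (m i (A i `&` ball (point : X i) n%:R) @[i --> omega]) <
    (c + n.+1%:R^-1)%:E)%E.
  apply: (@le_lt_trans _ _ c%:E); last by rewrite lte_fin ltrDl invr_gt0.
  apply: le_trans Ac; apply: lime_ge; first exact: content_cvg.
  apply: filterS (nbhs_pinfty_ge (num_real (n%:R : R))) => s ns.
  apply: lee_lim; [exact: ultra_cvg|exact: ultra_cvg|].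
  apply: filterS2 (mball_int n%:R mA) (mball_int s mA) => i mr ms.
  by apply: le_measure; rewrite ?inE//; apply: setIS; exact: le_ball.
exact: (@ultra_cvg _ _ UF _ _ (open_ereal_lt' h)).
Qed.

Lemma umeasurable_bigsetU (A : nat -> forall i, set (X i)) n :
  (forall k, umeasurable omega (A k)) ->
  umeasurable omega (fun i => \big[setU/set0]_(k < n) A k i).
Proof.
move=> mA; elim: n => [|n IH].
  by apply: filterE => i; rewrite big_ord0; exact: measurable0.
apply: filterS2 IH (mA n) => i; rewrite big_ord_recr; exact: measurableU.
Qed.

(* For each i take the union of the first N(i) sets, where N(i) is the largest
   n <= i for which this union is measurable and has mass < c + 1/(n+1) in the
   ball of radius n; non-principality gives N(i) -> oo along omega. *)
Lemma internalO_saturation (D : (set (uprod omega X))^nat) (c : R) :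
  (forall n, omega <> principal_filter n) ->
  (forall n, iO (D n)) ->
  (forall n, (mu (\big[setU/set0]_(k < n) D k) <= c%:E)%E) ->
  exists E, [/\ iO E, \bigcup_n D n `<=` E & (mu E <= c%:E)%E].
Proof.
move=> np iD Dc.
have /choice[A AD] : forall n, exists A : forall i, set (X i),
    umeasurable omega A /\ D n = ulim omega A `&` ufin omega X.
  by move=> n; have [_ [A mA <-] <-] := iD n; exists A.
pose V n i := \big[setU/set0]_(k < n) A k i.
have mV n : umeasurable omega (V n).
  by apply: umeasurable_bigsetU => k; have [] := AD k.
have Vle n p i : (n <= p)%N -> V n i `<=` V p i.
  by move=> np'; exact: (@subset_bigsetU _ (fun k => A k i)).
have DV n : \big[setU/set0]_(k < n) D k = ulim omega (V n) `&` ufin omega X.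
  rewrite ulim_bigsetU big_distrl/=.
  by apply: eq_bigr => k _; have [] := AD k.
(* The clause [n <= i] bounds the admissible [n], so that a largest one exists. *)
pose Q i n := [/\ (n <= i)%N,
  measurable (V n i : set (ballMeasurableType (X i))) &
  (m i (V n i `&` ball (point : X i) n%:R) < (c + n.+1%:R^-1)%:E)%E].
have nearQ n : \forall i \near omega, Q i n.
  have h := @nonprincipal_near_geq omega UF np n.
  have := @near_content_lt (V n) c n (mV n).
  rewrite -contentOE// -DV => /(_ (Dc n)).
  exact: filterS3 h (mV n).
have maxQ i n : Q i n -> exists2 N, Q i N & forall k, Q i k -> (k <= N)%N.
  move=> Qn; have exQ : exists k, `[< Q i k >] by exists n; exact/asboolP.
  have leQ k : `[< Q i k >] -> (k <= i)%N by move=> /asboolP[].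
  case: (ex_maxnP exQ leQ) => N /asboolP QN hN; exists N => // k /asboolP.
  exact: hN.
(* As [V n i] increases with [n], this union is its member of largest admissible index, whenever
   some index is admissible. *)
pose E i := \bigcup_(n in Q i) V n i.
have EV i n : Q i n -> exists N, [/\ (n <= N)%N, Q i N & E i = V N i].
  move=> Qn; have [N QN hN] := maxQ _ _ Qn; exists N; split=> //.
    exact: hN.
  apply/seteqP; split=> x; last by exists N.
  by move=> [k /hN kN]; exact: Vle.
have mE : umeasurable omega E.
  by apply: filterS (nearQ 0%N) => i /EV[N [_ [_ ? _] ->]].
exists (ulim omega E `&` ufin omega X); split.
- exact: internalO_ulim.
- move=> x [n _]; have [_ ->] := AD n => -[/ulim_repr Ax fx]; split=> //.
  (* The index is [n.+1] because [V n i] unites only the sets of index below [n]. *)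
  apply/ulim_repr; apply: filterS2 Ax (nearQ n.+1) => i Ai Qi.
  by exists n.+1 => //; rewrite /V big_ord_recr; right.
rewrite contentOE//; apply: lime_le; first exact: content_cvg.
apply: filterE => r; apply/lee_addgt0Pr => e e0.
apply: lime_le; first exact: ultra_cvg.
(* For every [N >= n] the ball of radius [N] contains that of radius [r], and the excess [1/(N+1)]
   is at most [e]. *)
pose n := maxn (Num.bound `|r|) (Num.bound e^-1).
have rn : r <= n%:R.
  apply: (@le_trans _ _ (Num.bound `|r|)%:R); last by rewrite ler_nat leq_maxl.
  by apply: le_trans (ler_norm r) _; apply/ltW/archi_boundP.
have en : n.+1%:R^-1 <= e.
  rewrite -[leRHS]invrK lef_pV2 ?posrE ?invr_gt0//.
  apply: (@le_trans _ _ (Num.bound e^-1)%:R); last first.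
    by rewrite ler_nat leqW// leq_maxr.
  by apply/ltW/archi_boundP; rewrite invr_ge0 ltW.
apply: filterS2 (nearQ n) mE => i /EV[N [nN [_ mN hN] EN]] mEi.
rewrite EN; apply: (@le_trans _ _ (m i (V N i `&` ball (point : X i) N%:R))).
  apply: le_measure; rewrite ?inE.
  - by apply: measurableI => //; exact: mball.
  - by apply: measurableI => //; exact: mball.
  - by apply: setIS; apply: le_ball; apply: le_trans rn _; rewrite ler_nat.
apply: le_trans (ltW hN) _; rewrite -EFinD lee_fin lerD2l.
by apply: le_trans en; rewrite lef_pV2 ?posrE// ler_nat.
Qed.

End content.

(** * Countable unions of null sets *)

Section countable_additivity.
Context {R : realType} (omega : set_system nat) {UF : UltraFilter omega}
        (nonprincipal : forall n, omega <> principal_filter n)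
        (X : nat -> pointedMetricType R)
        (m : forall i, {measure set (ballMeasurableType (X i)) -> \bar R}).
Local Notation iO := (internalO omega X).
Local Notation mu := (contentO omega m).
Local Notation null := (unull omega m).
Local Notation approx := (uapprox omega m).
Local Notation Bw := (usigma omega m).
Local Notation umu := (umeasure omega m).

Lemma unull_bigcup (N : (set (uprod omega X))^nat) :
  (forall n, null (N n)) -> null (\bigcup_n N n).
Proof.
move=> nN; split; first by move=> x [n _ Nx]; have [+ _] := nN n; exact.
move=> e e0.
(* The bounds sum to [e / 2]; the other half pays for the strict inequality, as saturation yields
   only a weak one. *)
have /choice[E hE] : forall n, exists E, [/\ iO E, N n `<=` E &
    (mu E < (e / 2 / 2 ^+ n.+1)%:E)%E].
  by move=> n; have [_] := nN n; apply; rewrite !divr_gt0// exprn_gt0.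
have iE n : iO (\big[setU/set0]_(k < n) E k).
  elim: n => [|n IH]; first by rewrite big_ord0; exact: internalO0.
  by rewrite big_ord_recr; apply: internalOU => //; have [] := hE n.
have Ele n : (mu (\big[setU/set0]_(k < n) E k) <= (e / 2 - e / 2 / 2 ^+ n)%:E)%E.
  elim: n => [|n IH].
    by rewrite big_ord0 contentO0 expr0 divr1 subrr.
  rewrite big_ord_recr; have [iEn _ /ltW En] := hE n.
  apply: le_trans (contentOU_le _ (iE n) iEn) _.
  apply: le_trans (leeD IH En) _.
  rewrite -EFinD lee_fin exprSr invfM mulrA -addrA lerD2l.
  by rewrite [X in - X + _]splitr opprD subrK.
have Ec n : (mu (\big[setU/set0]_(k < n) E k) <= (e / 2)%:E)%E.
  apply: le_trans (Ele n) _; rewrite lee_fin lerBlDr lerDl.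
  by rewrite !divr_ge0// ?exprn_ge0// ltW.
have iEn n : iO (E n) by have [] := hE n.
have [G [iG EG Ge]] := internalO_saturation nonprincipal iEn Ec.
exists G; split=> //.
  by move=> x [n _ Nx]; apply: EG; exists n => //; have [_ + _] := hE n; exact.
by apply: le_lt_trans Ge _; rewrite lte_fin ltr_pdivrMr// ltr_pMr// ltr1n.
Qed.

(** * Internal approximation inside a ball *)

Lemma uapprox_internalO A r D : approx A r D -> iO D.
Proof. by case. Qed.

Lemma uapprox0 r : approx set0 r set0.
Proof.
by split; [exact: internalO0|rewrite set0I /setY setDv setU0; exact: unull0].
Qed.

Lemma uapproxU A B r D E :
  approx A r D -> approx B r E -> approx (A `|` B) r (D `|` E).
Proof.
move=> [iD nD] [iE nE]; split; first exact: internalOU.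
apply: unullS (unullU nD nE) => x; rewrite /setY/setD/setU/setI/=.
by have [] := pselect (A x); have [] := pselect (B x);
  have [] := pselect (D x); have [] := pselect (E x); tauto.
Qed.

Lemma uapproxD A B r D E :
  approx A r D -> approx B r E -> approx (A `\` B) r (D `\` E).
Proof.
move=> [iD nD] [iE nE]; split; first exact: internalOD.
apply: unullS (unullU nD nE) => x; rewrite /setY/setD/setU/setI/=.
by have [] := pselect (A x); have [] := pselect (B x);
  have [] := pselect (D x); have [] := pselect (E x);
  have [] := pselect (uball omega X r x); tauto.
Qed.

(** Lets approximating sets be taken inside the ball, where uniform bounded finiteness makes
    contents finite. *)
Lemma uapproxIball A r D : approx A r D -> approx A r (D `&` uball omega X r).
Proof.
move=> [iD nD]; split; first by apply: internalOI => //; exact: internalO_uball.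
apply: unullS nD => x; rewrite /setY/setD/setU/setI/=.
by have [] := pselect (A x); have [] := pselect (D x); tauto.
Qed.

Lemma uapprox_ufin r : approx (ufin omega X) r (uball omega X r).
Proof.
split; first exact: internalO_uball.
rewrite setIidr; last exact: uball_ufin.
by rewrite /setY setDv setU0; exact: unull0.
Qed.

Lemma uapprox_bigsetU (F D : (set (uprod omega X))^nat) r n :
  (forall k, approx (F k) r (D k)) ->
  approx (\big[setU/set0]_(k < n) F k) r (\big[setU/set0]_(k < n) D k).
Proof.
move=> FD; elim: n => [|n IH]; first by rewrite !big_ord0; exact: uapprox0.
by rewrite !big_ord_recr; exact: uapproxU.
Qed.

(** A point of [D] outside [E] is in the error set of [D], or else in [A] and the ball of radius
    [r], hence in [B] and the ball of radius [s], hence in the error set of [E]. *)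
Lemma uapprox_le A B r s D E : A `<=` B -> r <= s ->
  approx A r D -> approx B s E -> (mu D <= mu E)%E.
Proof.
move=> AB rs [iD nD] [iE nE]; apply: contentO_le => //.
apply: unullS (unullU nD nE) => x; rewrite /setY/setD/setU/setI/=.
have := AB x; have := @uball_le _ omega UF X _ _ rs x.
by have [] := pselect (A x); have [] := pselect (B x);
  have [] := pselect (D x); have [] := pselect (E x);
  have [] := pselect (uball omega X r x); tauto.
Qed.

Context (bounded : unif_boundedly_finite omega m).

(* Saturation provides an internal set containing all approximations with no
   more content than their supremum; since the latter is finite, the excess is
   a null set. *)
Lemma uapprox_bigcup (F D : (set (uprod omega X))^nat) r : 0 < r ->
  (forall n, approx (F n) r (D n)) ->
  exists2 G, approx (\bigcup_n F n) r G &
    mu G = ereal_sup (range (fun n => mu (\big[setU/set0]_(k < n) D k))).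
Proof.
move=> r0 FD.
pose E n := D n `&` uball omega X r.
have FE n : approx (F n) r (E n) by exact: uapproxIball.
pose V n := \big[setU/set0]_(k < n) E k.
have FV n : approx (\big[setU/set0]_(k < n) F k) r (V n).
  exact: uapprox_bigsetU.
have iV n : iO (V n) by exact: uapprox_internalO (FV n).
rewrite (_ : (fun n => mu _) = mu \o V); last first.
  by apply/funext => n; exact: uapprox_content (uapprox_bigsetU _ FD) (FV n).
set s := ereal_sup _.
have Vs n : (mu (V n) <= s)%E by apply: ereal_sup_ubound; exists n.
have sfin : s \is a fin_num.
  rewrite ge0_fin_numE; last exact: le_trans (contentO_ge0 _ (iV 0%N)) (Vs _).
  apply: (@le_lt_trans _ _ (mu (uball omega X r))).
    apply: ge_ereal_sup => _ [n _ <-]; apply: le_contentO => //.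
      exact: internalO_uball.
    by rewrite /V -bigcup_mkord => x [k _ []].
  by apply: (contentO_uball_lty bounded r0) => //; exact: internalO_uball.
have Vc n : (mu (V n) <= (fine s)%:E)%E by rewrite fineK.
have [G [iG EG Gs]] := internalO_saturation nonprincipal
  (fun n => uapprox_internalO (FE n)) Vc.
rewrite fineK// in Gs.
have VG n : V n `<=` G by apply: subset_trans EG; exact: bigsetU_bigcup.
(* [G] exceeds each [V n] by content at most [s - mu (V n)], which is below [e] for a suitable
   [n]. *)
have nG : null (G `\` \bigcup_n E n).
  split; first by move=> x [Gx _]; exact: internalO_ufin iG _ Gx.
  move=> e e0; have [_ [n _ <-] Vn] := ub_ereal_sup_adherent e0 sfin.
  exists (G `\` V n); split; first exact: internalOD.
    by move=> x [Gx nE]; split=> // Vx; apply: nE; exact: bigsetU_bigcup Vx.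
  have := contentOID m iG (iV n); rewrite setIidr// => eG.
  move: Gs; rewrite eG => Gs.
  have Vfin : mu (V n) \is a fin_num.
    rewrite ge0_fin_numE ?contentO_ge0//; apply: le_lt_trans (Vs n) _.
    by rewrite -ge0_fin_numE// (le_trans _ (Vs n))// contentO_ge0.
  rewrite -(@lteD2lE _ (mu (V n)))//; apply: le_lt_trans Gs _.
  by rewrite -lteBlDr.
exists G; last first.
  apply/eqP; rewrite eq_le Gs/=; apply: ge_ereal_sup => _ [n _ <-].
  exact: le_contentO.
(* The error of [G] is covered by its excess over the union of the [E n] and the countably many
   errors of the [E n]. *)
split=> //; apply: unullS (unullU nG (unull_bigcup (fun n => (FE n).2))) => x.
move=> [[[[n _ Fx] rx] nGx]|[Gx nFx]].
  by right; exists n => //; left; split=> // Ex; apply: nGx; apply: EG; exists n.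
have [[n _ Ex]|nE] := pselect ((\bigcup_n E n) x); last by left.
right; exists n => //; right; split=> // -[Fx rx]; apply: nFx; split=> //.
by exists n.
Qed.

(** * The sigma-algebra of approximable sets *)

Lemma usigma_ufin A : Bw A -> A `<=` ufin omega X. Proof. by case. Qed.

Lemma usigma0 : Bw set0.
Proof. by split=> // r _; exists set0; exact: uapprox0. Qed.

Lemma usigmaC A : Bw A -> Bw (ufin omega X `\` A).
Proof.
move=> [_ hA]; split; first by move=> x [].
move=> r r0; have [D AD] := hA r r0.
by exists (uball omega X r `\` D); exact: uapproxD (uapprox_ufin r) AD.
Qed.

Lemma usigma_bigcup (F : (set (uprod omega X))^nat) :
  (forall n, Bw (F n)) -> Bw (\bigcup_n F n).
Proof.
move=> BF; split; first by move=> x [n _]; exact: usigma_ufin (BF n) x.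
move=> r r0; have /choice[D FD] : forall n, exists D, approx (F n) r D.
  by move=> n; have [_] := BF n; exact.
by have [G FG _] := uapprox_bigcup r0 FD; exists G.
Qed.

Lemma usigmaU A B : Bw A -> Bw B -> Bw (A `|` B).
Proof.
move=> [fA hA] [fB hB]; split; first by rewrite subUset.
move=> r r0; have [D AD] := hA r r0; have [E BE] := hB r r0.
by exists (D `|` E); exact: uapproxU.
Qed.

Lemma usigma_bigsetU (F : (set (uprod omega X))^nat) n :
  (forall n, Bw (F n)) -> Bw (\big[setU/set0]_(k < n) F k).
Proof.
move=> BF; elim: n => [|n IH]; first by rewrite big_ord0; exact: usigma0.
by rewrite big_ord_recr; exact: usigmaU.
Qed.

(** * The extended set-function and its additivity *)

Lemma umeasure_cvg A : Bw A -> exists2 D : R -> set (uprod omega X),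
  (forall r, 0 < r -> approx A r (D r)) & mu (D r) @[r --> +oo%R] --> umu A.
Proof.
move=> [_ hA].
(* [D r] is made empty for [r <= 0], where nothing is prescribed, so that its content is
   nondecreasing on the whole line and therefore converges. *)
have /choice[D hD] : forall r : R, exists D,
    (0 < r -> approx A r D) /\ (r <= 0 -> D = set0).
  move=> r; have [r0|r0] := leP r 0.
    by exists set0; split=> // /(le_lt_trans r0); rewrite ltxx.
  by have [D AD] := hA r r0; exists D; split=> // /(lt_le_trans r0); rewrite ltxx.
have AD r : 0 < r -> approx A r (D r) by case: (hD r).
exists D => //; rewrite (umeasureE AD); apply: nondecreasing_is_cvge => r s rs.
have [s0|s0] := leP s 0.
  by rewrite (hD r).2 ?(le_trans rs)// (hD s).2.
have [r0|r0] := leP r 0.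
  rewrite (hD r).2// contentO0 contentO_ge0//.
  exact: uapprox_internalO (AD _ s0).
exact: uapprox_le rs (AD _ r0) (AD _ s0).
Qed.

(** Together with [umeasure_le] this makes [umu A] the supremum of the contents of its approximating
    sets, which removes limits in the radius from later comparisons. *)
Lemma uapprox_le_umeasure A r D : Bw A -> 0 < r -> approx A r D ->
  (mu D <= umu A)%E.
Proof.
move=> BA r0 AD; have [E AE cE] := umeasure_cvg BA.
apply: (cvge_to_ge cE); apply: filterS (nbhs_pinfty_ge (num_real r)) => s rs.
exact: uapprox_le rs AD (AE s (lt_le_trans r0 rs)).
Qed.

Lemma umeasure_le A c : Bw A ->
  (forall r D, 0 < r -> approx A r D -> (mu D <= c)%E) -> (umu A <= c)%E.
Proof.
move=> BA hc; have [E AE cE] := umeasure_cvg BA.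
apply: (cvge_to_le cE); apply: filterS (nbhs_pinfty_gt (num_real (0 : R))).
by move=> r r0; apply: hc (AE r r0).
Qed.

Lemma umeasure_ge0 A : Bw A -> (0 <= umu A)%E.
Proof.
move=> BA; have [_ /(_ 1 ltr01)[D AD]] := BA.
apply: le_trans (uapprox_le_umeasure BA ltr01 AD).
exact: contentO_ge0 (uapprox_internalO AD).
Qed.

Lemma umeasure0 : umu set0 = 0%E.
Proof.
apply/eqP; rewrite eq_le (umeasure_ge0 usigma0) andbT.
apply: umeasure_le usigma0 _ => r D _ D0.
by rewrite (uapprox_content D0 (uapprox0 r)) contentO0.
Qed.

Lemma le_umeasure A B : Bw A -> Bw B -> A `<=` B -> (umu A <= umu B)%E.
Proof.
move=> BA BB AB; apply: umeasure_le => // r D r0 AD.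
have [_ /(_ r r0)[E BE]] := BB.
exact: le_trans (uapprox_le AB (lexx r) AD BE) (uapprox_le_umeasure BB r0 BE).
Qed.

Lemma umeasureU A B : Bw A -> Bw B -> A `&` B = set0 ->
  umu (A `|` B) = (umu A + umu B)%E.
Proof.
move=> BA BB AB; have [D AD cD] := umeasure_cvg BA.
have [E BE cE] := umeasure_cvg BB.
rewrite (umeasureE (fun r r0 => uapproxU (AD r r0) (BE r r0))).
have dAB : (umu A +? umu B)%E by rewrite ge0_adde_def ?inE ?umeasure_ge0.
apply: cvg_lim => //.
apply: cvg_trans (cvgeD dAB cD cE).
apply: near_eq_cvg; apply: filterS (nbhs_pinfty_gt (num_real (0 : R))) => r r0.
have [iD nD] := AD r r0; have [iE nE] := BE r r0.
(* A common point of [D r] and [E r] cannot lie in both [A] and [B], so it lies in one of the two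
   error sets. *)
rewrite contentOU//; apply: unullS (unullU nD nE) => x [Dx Ex].
have [Ax|nAx] := pselect (A x); last by left; right; split=> // -[].
by right; right; split=> // -[Bx _]; rewrite -[False]/(set0 x) -AB.
Qed.

Lemma umeasure_bigsetU (F : (set (uprod omega X))^nat) n :
  (forall n, Bw (F n)) -> trivIset setT F ->
  umu (\big[setU/set0]_(k < n) F k) = (\sum_(k < n) umu (F k))%E.
Proof.
move=> BF tF; elim: n => [|n IH]; first by rewrite !big_ord0 umeasure0.
rewrite !big_ord_recr/= umeasureU ?IH//; first exact: usigma_bigsetU.
apply/seteqP; split=> // x [+ Fn]; rewrite -bigcup_mkord => -[k /= kn Fk].
have : k = n by apply: tF => //; exists x.
by move=> e; rewrite e ltnn in kn.
Qed.

(** Finite additivity turns the partial sums into measures of finite unions, so continuity from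
    below along these unions suffices. *)
Lemma umeasure_sigma_additive (F : (set (uprod omega X))^nat) :
  (forall n, Bw (F n)) -> trivIset setT F ->
  (\sum_(0 <= k < n) umu (F k))%E @[n --> \oo] --> umu (\bigcup_n F n).
Proof.
move=> BF tF; under eq_fun do rewrite big_mkord -umeasure_bigsetU//.
pose u n := umu (\big[setU/set0]_(k < n) F k).
have BV n := usigma_bigsetU n BF.
have ndu : nondecreasing_seq u.
  by move=> n p np; apply: le_umeasure => //; exact: subset_bigsetU.
suff -> : umu (\bigcup_n F n) = ereal_sup (range u).
  exact: ereal_nondecreasing_cvgn.
have BU := usigma_bigcup BF.
apply/eqP; rewrite eq_le; apply/andP; split; last first.
  apply: ge_ereal_sup => _ [n _ <-]; apply: le_umeasure => //.
  exact: bigsetU_bigcup.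
(* Two suprema are exchanged: at a fixed radius the content of the whole union is the supremum over
   finite unions, and each of those contents is at most the measure of its finite union. *)
apply: umeasure_le => // r G r0 FG.
have /choice[D FD] : forall n, exists D, approx (F n) r D.
  by move=> n; have [_] := BF n; exact.
have [E FE eE] := uapprox_bigcup r0 FD.
rewrite (uapprox_content FG FE) eE; apply: ge_ereal_sup => _ [n _ <-].
apply: (@le_trans _ _ (u n)); last by apply: ereal_sup_ubound; exists n.
by apply: uapprox_le_umeasure r0 _ => //; exact: uapprox_bigsetU.
Qed.

End countable_additivity.

Theorem theorem7p13 (R : realType) (omega : set_system nat)
    (UF : UltraFilter omega)
    (nonprincipal : forall n, omega <> principal_filter n)
    (X : nat -> pointedMetricType R)
    (m : forall i, {measure set (ballMeasurableType (X i)) -> \bar R}) :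
  unif_boundedly_finite omega m ->
  sigma_algebra (ufin omega X) (usigma omega m) /\
  is_measure_on (usigma omega m) (umeasure omega m).
Proof.
move=> bounded; split; split.
- exact: usigma0.
- exact: usigmaC.
- exact: usigma_bigcup.
- exact: umeasure0.
- exact: umeasure_ge0.
- exact: umeasure_sigma_additive.
Qed.
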